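(* For each $\gamma \in (0,\frac{1}{2}]$ and each $0<\delta<1$, there exists a sequence $(x_n)_{n\in\mathbb{N}}$ that has weak $\gamma$-PPC (with parameter $\delta$) and is not equidistributed.
   Context: $\|\cdot\|$ denotes the distance to the nearest integer, and $\sharp$ denotes cardinality; pairs $(m,n)$ below are ordered pairs. For $\gamma\in(0,1)$ and $0<\delta<1$, a sequence $(x_n)_{n\in\mathbb{N}}$ of real numbers has weak $\gamma$-PPC (with parameter $\delta$) if for every $s>0$, $$\lim_{N\to\infty}\frac{1}{N^{2-\delta}}\,\sharp \left\{ 1 \leq m \neq n \leq N : \|x_m - x_n-\gamma\| \leq \frac{s}{N^{\delta}} \right\} =2s.$$ A real sequence $(x_n)_{n\in\mathbb{N}}$ is equidistributed (uniformly distributed modulo one) if for every interval $[a,b]\subseteq[0,1)$, $$\lim_{N \to \infty} \frac{\sharp \{1\le n\le N : x_n \bmod 1 \in [a, b]\}}{N}=b-a.$$ *)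

(* Defs.v *)
From mathcomp Require Import all_boot all_order all_algebra.
From mathcomp Require Import all_classical all_reals all_analysis.
Set Implicit Arguments.
Unset Strict Implicit.
Unset Printing Implicit Defensive.
Import Order.TTheory GRing.Theory Num.Theory.
Import numFieldNormedType.Exports.
Local Open Scope classical_set_scope.
Local Open Scope ring_scope.

Definition dist_int (R : realType) (x : R) : R :=
  inf (range (fun k : int => `|x - k%:~R|)).

Definition mod1 (R : realType) (x : R) : R := x - (Num.floor x)%:~R.

(* Sequences are indexed from 1: the value [x 0] is never used. *)

Definition pair_count (R : realType) (x : nat -> R) (gamma r : R) (N : nat)
    : nat :=
  #|[set p : 'I_N.+1 * 'I_N.+1 |
      [&& (1 <= p.1)%N, (1 <= p.2)%N, p.1 != p.2
        & dist_int (x p.1 - x p.2 - gamma) <= r]]%SET|.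

Definition weak_PPC (R : realType) (gamma delta : R) (x : nat -> R) : Prop :=
  forall s : R, 0 < s ->
    (fun N : nat => (pair_count x gamma (s / N%:R `^ delta) N)%:R
                      / N%:R `^ (2 - delta)) @ \oo --> 2 * s.

Definition visit_count (R : realType) (x : nat -> R) (a b : R) (N : nat)
    : nat :=
  #|[set n : 'I_N.+1 | (1 <= n)%N && (a <= mod1 (x n) <= b)]%SET|.

Definition equidistributed (R : realType) (x : nat -> R) : Prop :=
  forall a b : R, 0 <= a -> a <= b -> b < 1 ->
    (fun N : nat => (visit_count x a b N)%:R / N%:R) @ \oo --> b - a.

(* Main.v *)
(** Let [y] be the base-2 van der Corput sequence, whose discrepancy is
   O(log N), and collapse every point with ||y_n|| <= gamma/2 to the atom 0.
   The atom has mass gamma > 0, so equidistribution fails.  Two points of the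
   collapsed arc are (up to its boundary) never at distance gamma from each
   other, before or after the collapse, as the arc has length gamma <= 1/2.
   A collapsed point and a point outside the arc are paired exactly when the
   latter lies within r = s/N^delta of +-gamma, and the arc is disjoint from
   these neighbourhoods; since the number of points in an interval of length 2r
   is 2rN + O(log N) wherever it is centred, the collapse changes the number of
   pairs only by a lower order term.

   The discrepancy bound comes from the sawtooth psi(u) = floor(u) - u + 1/2:
   the indicator of ||z|| <= r is 2r + psi(r+z) + psi(r-z). *)
Require Import Defs.
From mathcomp Require Import all_boot all_order all_algebra.
From mathcomp Require Import all_classical all_reals all_analysis.
From mathcomp Require Import lra ring zify.
Set Implicit Arguments.
Unset Strict Implicit.
Unset Printing Implicit Defensive.
Import Order.TTheory GRing.Theory Num.Theory.
Import numFieldNormedType.Exports.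
Local Open Scope classical_set_scope.
Local Open Scope ring_scope.

(** * Distance to the nearest integer *)

Lemma dist_int_le (R : realType) (x : R) (k : int) :
  dist_int x <= `|x - k%:~R|.
Proof.
apply: ge_inf; last by exists k.
by exists 0 => _ [j _ <-]; exact: normr_ge0.
Qed.

Lemma dist_int_attained (R : realType) (x : R) :
  exists k : int, dist_int x = `|x - k%:~R|.
Proof.
set f := Num.floor x.
have /andP[fle flt] := floor_itv x; rewrite intrD -/f in flt; rewrite -/f in fle.
have lb (c : R) : c <= x - f%:~R -> c <= f%:~R + 1 - x -> c <= dist_int x.
  move=> c1 c2; apply: lb_le_inf; first by exists `|x - 0%:~R|, 0.
  move=> _ [k _ <-]; have [kf|fk] := leP k f.
    have : k%:~R <= f%:~R :> R by rewrite ler_int.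
    by move=> kf'; rewrite ger0_norm; lra.
  have : (f + 1)%:~R <= k%:~R :> R by rewrite ler_int lezD1.
  by rewrite intrD => kf'; rewrite ler0_norm; lra.
have [h|h] := leP (x - f%:~R) (f%:~R + 1 - x).
  exists f; apply/eqP; rewrite eq_le dist_int_le ger0_norm ?subr_ge0 //=.
  exact: lb.
exists (f + 1); apply/eqP; rewrite eq_le dist_int_le intrD ler0_norm; last lra.
by apply: lb; lra.
Qed.

Lemma dist_int_small (R : realType) (x : R) :
  `|x| <= 1 / 2 -> dist_int x = `|x|.
Proof.
move=> hx; apply/eqP; rewrite eq_le.
have := dist_int_le x 0; rewrite subr0 => -> /=.
have [k ->] := dist_int_attained x.
have [->|k0] := eqVneq k 0; first by rewrite subr0.
have k1 : 1 <= `|k%:~R| :> R by rewrite -intr_norm (ler_int _ 1) -gtz0_ge1 normr_gt0.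
by have := ler_normB x (x - k%:~R); rewrite subKr; lra.
Qed.

Lemma dist_intN (R : realType) (x : R) : dist_int (- x) = dist_int x.
Proof.
suff le y : dist_int (- y) <= dist_int (y : R).
  by apply/eqP; rewrite eq_le le; have := le (- x); rewrite opprK.
have [k ->] := dist_int_attained y.
by have := dist_int_le (- y) (- k); rewrite intrN -opprD normrN.
Qed.

Lemma dist_intD (R : realType) (x y : R) :
  dist_int (x + y) <= dist_int x + dist_int y.
Proof.
have [k ->] := dist_int_attained x; have [l ->] := dist_int_attained y.
apply: le_trans (ler_normD _ _).
by rewrite addrACA -opprD -intrD; exact: dist_int_le.
Qed.

(** * The sawtooth function and indicators of short arcs *)

Definition sawtooth (R : realType) (u : R) : R := (Num.floor u)%:~R - u + 1 / 2.

Lemma sawtooth_bound (R : realType) (u : R) : `|sawtooth u| <= 1 / 2.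
Proof.
have /andP[] := floor_itv u; rewrite intrD /sawtooth ler_norml => h1 h2.
by apply/andP; split; lra.
Qed.

Lemma sawtooth_periodic (R : realType) (u : R) (k : int) :
  sawtooth (u + k%:~R) = sawtooth u.
Proof. by rewrite /sawtooth floorDrz ?intr_int// intrKfloor intrD; ring. Qed.

(** Hermite's identity floor(u) + floor(u + 1/2) = floor(2u). The offset 1/2 in [sawtooth] is the
    one that leaves no constant term. *)
Lemma sawtooth_double (R : realType) (u : R) :
  sawtooth u + sawtooth (u + 1 / 2) = sawtooth (2 * u).
Proof.
have /andP[] := floor_itv u; rewrite intrD /sawtooth => h1 h2.
set f := Num.floor u in h1 h2 *.
have [h|h] := ltP u (f%:~R + 1 / 2).
  rewrite (@floor_def _ (u + 1 / 2) f); last by rewrite intrD; apply/andP; split; lra.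
  rewrite (@floor_def _ (2 * u) (f + f)); last by rewrite !intrD; apply/andP; split; lra.
  by rewrite intrD; field.
rewrite (@floor_def _ (u + 1 / 2) (f + 1));
  last by rewrite !intrD; apply/andP; split; lra.
rewrite (@floor_def _ (2 * u) (f + f + 1));
  last by rewrite !intrD; apply/andP; split; lra.
by rewrite !intrD; field.
Qed.

(** The right-hand side equals floor(r+z) + floor(r-z) + 1, the number of integers in the closed
    interval [z-r, z+r]; as 2r < 1, there is at most one. *)
Lemma dist_int_le_sawtooth (R : realType) (z r : R) : 0 <= r -> r < 1 / 2 ->
  (dist_int z <= r)%R%:R = 2 * r + sawtooth (r + z) + sawtooth (r - z).
Proof.
move=> r0 r12; rewrite /sawtooth; case: (leP (dist_int z) r) => [|zr].
  have [k ->] := dist_int_attained z; rewrite ler_norml => /andP[h1 h2].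
  rewrite (@floor_def _ (r + z) k); last by rewrite intrD; apply/andP; split; lra.
  rewrite (@floor_def _ (r - z) (- k));
    last by rewrite intrD intrN; apply/andP; split; lra.
  by rewrite intrN /=; field.
have /andP[] := floor_itv (r + z); set k := Num.floor (r + z); rewrite intrD => h1 h2.
have := lt_le_trans zr (dist_int_le z k); rewrite ltr_normr => h.
rewrite (@floor_def _ (r - z) (- k - 1)); last first.
  by rewrite !intrD !intrN; move: h => /orP[h|h]; apply/andP; split; lra.
by rewrite intrD !intrN /=; field.
Qed.

(** * The van der Corput sequence and its discrepancy *)

(** Reflects the binary digits of [n] at the binary point. The fuel makes the recursion structural;
    [n] has at most [n] digits, so fuel [n] suffices. *)
Fixpoint vdc_digits (R : realType) (fuel n : nat) : R :=
  if fuel is k.+1 then ((odd n)%:R + vdc_digits R k n./2) / 2 else 0.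

Definition vdc (R : realType) (n : nat) : R := vdc_digits R n n.

Lemma vdc_digits_fuel (R : realType) (k n : nat) :
  (n <= k)%N -> vdc_digits R k n = vdc R n.
Proof.
have stable j : forall m, (m <= j)%N -> vdc_digits R j.+1 m = vdc_digits R j m.
  elim: j => [|j IH] m mj; first by rewrite (_ : m = 0)%N /=; [lra|lia].
  by rewrite [LHS]/= -/(vdc_digits R j.+1 m./2) IH //; lia.
elim: k => [|k IH] nk; first by rewrite (_ : n = 0)%N //; lia.
have [->//|nk'] := eqVneq n k.+1.
by rewrite stable ?IH //; lia.
Qed.

Lemma vdc_rec (R : realType) (n : nat) : vdc R n = ((odd n)%:R + vdc R n./2) / 2.
Proof.
by rewrite -(@vdc_digits_fuel R n.+1 n) //= vdc_digits_fuel //; lia.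
Qed.

Lemma sum_pairs (R : realType) (F : nat -> R) (M : nat) :
  \sum_(i < M.*2) F i = \sum_(i < M) (F i.*2 + F i.*2.+1).
Proof.
elim: M => [|M IH]; first by rewrite !big_ord0.
by rewrite doubleS !big_ord_recr /= IH addrA.
Qed.

(* The points [vdc (2 n)] and [vdc (2 n + 1)] are the two halves of
   [vdc n] modulo 1, so the duplication formula of the sawtooth turns the sum
   over [2 M] points into one over [M] points, at twice the argument. *)
Lemma vdc_sawtooth_sum (R : realType) (k N : nat) (c : int) (a : R) :
  c = 1 \/ c = -1 -> (N < 2 ^ k)%N ->
  `|\sum_(i < N) sawtooth (a + c%:~R * vdc R i)| <= k%:R / 2.
Proof.
move=> c1; elim: k N a => [|k IH] N a Nk.
  by rewrite (_ : N = 0)%N ?big_ord0 ?normr0 ?mul0r //; lia.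
have even M : `|\sum_(i < M.*2) sawtooth (a + c%:~R * vdc R i)|
    = `|\sum_(i < M) sawtooth (2 * a + c%:~R * vdc R i)|.
  rewrite (@sum_pairs R (fun i => sawtooth (a + c%:~R * vdc R i))).
  congr `| _ |; apply: eq_bigr => i _.
  rewrite (vdc_rec R i.*2) (vdc_rec R i.*2.+1) /= odd_double doubleK uphalf_double /=.
  rewrite add0r (_ : 2 * a + _ = 2 * (a + c%:~R * (vdc R i / 2))); last by field.
  rewrite -sawtooth_double; congr (_ + _).
  case: c1 => ->; first by congr sawtooth; field.
  (* For c = -1 the odd-indexed term is shifted by -1/2; a full period turns this into +1/2. *)
  rewrite -[LHS](sawtooth_periodic _ 1).
  by congr sawtooth; field.
rewrite expnS in Nk; rewrite -(odd_double_half N) addnC; case: (odd N) => /=; last first.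
  rewrite addn0 even; apply: le_trans (IH _ _ _) _; first by lia.
  by rewrite -[k.+1%:R]natr1; lra.
rewrite addn1 big_ord_recr /=; apply: le_trans (ler_normD _ _) _.
rewrite -[k.+1%:R]natr1 mulrDl lerD ?even ?IH ?sawtooth_bound //; lia.
Qed.

(** Removing the mean [2 * r] from the indicators leaves two sawtooth sums, with c = 1 and c = -1,
    each at most half the exponent of a power of 2 above [N]. The bound is uniform in the centre
    [t]. *)
Lemma vdc_discrepancy (R : realType) (N : nat) (t r : R) :
  0 <= r -> r < 1 / 2 ->
  `|\sum_(i < N) (dist_int (vdc R i - t) <= r)%R%:R - 2 * r * N%:R|
    <= (trunc_log 2 N).+1%:R.
Proof.
move=> r0 r12; have Nk := @trunc_log_ltn 2 N isT.
have -> : 2 * r * N%:R = \sum_(i < N) (2 * r) by rewrite sumr_const card_ord mulr_natr.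
rewrite -sumrB.
under eq_bigr => i _.
  rewrite dist_int_le_sawtooth // addrAC (addrAC (2 * r)) subrr add0r.
  rewrite (_ : r + _ = (r - t) + 1%:~R * vdc R i); last by ring.
  rewrite (_ : r - (_ - _) = (r + t) + (-1)%:~R * vdc R i); last by rewrite intrN; ring.
  over.
rewrite big_split /=; apply: le_trans (ler_normD _ _) _.
rewrite [leRHS]splitr; apply: lerD; apply: vdc_sawtooth_sum => //; [by left|by right].
Qed.

(** * Counting functions as sums of indicators *)

Lemma pair_count_sum (R : realType) (x : nat -> R) (gamma r : R) (N : nat) :
  (pair_count x gamma r N)%:R = \sum_(i < N) \sum_(j < N)
     ((i != j) && (dist_int (x i.+1 - x j.+1 - gamma) <= r)%R)%:R :> R.
Proof.
pose P (i j : 'I_N.+1) := [&& (1 <= i)%N, (1 <= j)%N, i != j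
  & (dist_int (x i - x j - gamma) <= r)%R].
have -> : (pair_count x gamma r N)%:R = \sum_i \sum_j (P i j)%:R :> R.
  rewrite pair_bigA /= /pair_count cardsE -sum1_card natr_sum big_mkcond /=.
  by apply: eq_bigr => p _; rewrite unfold_in /= -/(P _ _); case: (P _ _).
rewrite big_ord_recl big1 ?add0r //.
apply: eq_bigr => i _; rewrite big_ord_recl {1}/P /= add0r.
by apply: eq_bigr => j _; rewrite /P /= (inj_eq lift_inj).
Qed.

Lemma visit_count_sum (R : realType) (x : nat -> R) (a b : R) (N : nat) :
  (visit_count x a b N)%:R = \sum_(i < N) (a <= mod1 (x i.+1) <= b)%R%:R :> R.
Proof.
rewrite /visit_count cardsE -sum1_card natr_sum big_mkcond /=.
rewrite big_ord_recl unfold_in /= add0r.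
by apply: eq_bigr => i _; rewrite unfold_in /=; case: (_ && _).
Qed.

Lemma norm_sum_le (R : realType) (N : nat) (F : 'I_N -> R) (B : R) :
  (forall i, `|F i| <= B) -> `|\sum_(i < N) F i| <= N%:R * B.
Proof.
move=> FB; apply: le_trans (ler_norm_sum _ _ _) _.
by rewrite mulr_natl -[X in _ *+ X](card_ord N) -sumr_const; exact: ler_sum.
Qed.

(** * The collapsed sequence and its pair count *)

(** The predecessor reconciles indexing from 1 with discrepancy sums that start at [vdc R 0]. *)
Definition vdc_atom (R : realType) (gamma : R) (n : nat) : R :=
  if dist_int (vdc R n.-1) <= gamma / 2 then 0 else vdc R n.-1.

(** Four cases, by which of the two points are collapsed. If both are, the left side is 0 because
    gamma > r, and the right side reduces to [I (y n + gamma) + I (y m - gamma)], which vanishes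
    too: points of the arc stay at least gamma/2 > r away from gamma and -gamma. *)
Lemma vdc_atom_indicator (R : realType) (gamma r : R) (m n : nat) :
  0 < gamma -> gamma <= 1 / 2 -> 0 <= r -> r < gamma / 4 ->
  let y := vdc R in
  let I (z : R) : R := (dist_int z <= r)%R%:R in
  let a k : R := (dist_int (y k) <= gamma / 2)%R%:R in
  ((m != n) && (dist_int (vdc_atom gamma m.+1 - vdc_atom gamma n.+1 - gamma) <= r)%R)%:R
  = I (y m - y n - gamma)
    - a m * (I (y m - y n - gamma) - I (y n + gamma))
    - a n * (I (y m - y n - gamma) - I (y m - gamma))
    + a m * a n * I (y m - y n - gamma).
Proof.
move=> g0 g12 r0 rg y I a.
have dg : dist_int gamma = gamma by rewrite dist_int_small ger0_norm; lra.
have dNg : dist_int (- gamma) = gamma by rewrite dist_intN.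
have I0 k z : (dist_int (y k) <= gamma / 2) -> dist_int (- y k + z) <= r ->
    gamma <= dist_int z -> False.
  move=> h1 h2 h3; have := dist_intD (- y k + z) (y k).
  by rewrite addrAC addNr add0r; lra.
have -> : (m != n) && (dist_int (vdc_atom gamma m.+1 - vdc_atom gamma n.+1 - gamma) <= r)
    = (dist_int (vdc_atom gamma m.+1 - vdc_atom gamma n.+1 - gamma) <= r).
  have [->|//] := eqVneq m n; rewrite subrr add0r dNg /=.
  by apply/esym/negbTE; rewrite -ltNge; lra.
rewrite /vdc_atom /= -/y /I /a.
case: ifP => hm; case: ifP => hn; rewrite ?subr0 ?mul1r ?mul0r ?mulr1 ?mulr0 ?addr0.
- rewrite add0r dNg (_ : (gamma <= r) = false); last by apply/negbTE; rewrite -ltNge; lra.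
  rewrite (_ : (dist_int (y n + gamma) <= r) = false); last first.
    apply/negP => h; apply: (I0 n (- gamma) hn); last by rewrite dNg.
    by rewrite -opprD dist_intN.
  rewrite (_ : (dist_int (y m - gamma) <= r) = false); last first.
    apply/negP => h; apply: (I0 m gamma hm); last by rewrite dg.
    by rewrite -dist_intN opprD opprK.
  by rewrite /=; ring.
- by rewrite sub0r -opprD dist_intN; ring.
- by ring.
- by ring.
Qed.

(** [S1] is the error of the uncollapsed sequence. [S2] and [S3] compare arcs of equal length, so
    their main terms cancel; with [S1] they cost (1 + 2 + 2) N D. [S4] counts pairs inside the arc
    and gives the product term. *)
Lemma vdc_atom_pair_count (R : realType) (gamma r D : R) (N : nat) :
  0 < gamma -> gamma <= 1 / 2 -> 0 < r -> r < gamma / 4 ->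
  D = (trunc_log 2 N).+1%:R ->
  `|(pair_count (vdc_atom gamma) gamma r N)%:R - 2 * r * N%:R ^+ 2|
    <= 5 * N%:R * D + (4 * r * N%:R + 2 * D) * (2 * r * N%:R + D).
Proof.
move=> g0 g12 r0 rg DE; set y := vdc R.
have dg : dist_int gamma = gamma by rewrite dist_int_small ger0_norm; lra.
pose I (z : R) : R := (dist_int z <= r)%R%:R.
pose a k : R := (dist_int (y k) <= gamma / 2)%R%:R.
(* The arc shrunk by 2r at each end, of nonnegative radius as r < gamma/4. A pair with one point
   here and the other in the full arc would give gamma <= r + (gamma/2 - 2r) + gamma/2 < gamma. *)
pose e k : R := (dist_int (y k) <= gamma / 2 - 2 * r)%R%:R.
have disc (t rho : R) : 0 <= rho -> rho < 1 / 2 ->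
    `|\sum_(i < N) (dist_int (y i - t) <= rho)%R%:R - 2 * rho * N%:R| <= D.
  by rewrite DE; exact: vdc_discrepancy.
have a0 k : 0 <= a k by exact: ler0n.
have a1 k : a k <= 1 by rewrite /a lern1 leq_b1.
have I0 z : 0 <= I z by exact: ler0n.
have row i : `|\sum_(j < N) I (y i - y j - gamma) - 2 * r * N%:R| <= D.
  under eq_bigr => j _.
    by rewrite /I -dist_intN !opprB addrCA -opprB; over.
  by apply: disc; lra.
have col j : `|\sum_(i < N) I (y i - y j - gamma) - 2 * r * N%:R| <= D.
  under eq_bigr => i _ do rewrite /I -addrA -opprD.
  by apply: disc; lra.
have rowb : `|\sum_(j < N) I (y j + gamma) - 2 * r * N%:R| <= D.
  have := @disc (- gamma) r; under eq_bigr do rewrite opprK.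
  by apply; lra.
have colc : `|\sum_(i < N) I (y i - gamma) - 2 * r * N%:R| <= D by apply: disc; lra.
have diff (u v w : R) : `|u - w| <= D -> `|v - w| <= D -> `|u - v| <= 2 * D.
  by rewrite !ler_norml => /andP[? ?] /andP[? ?]; apply/andP; split; lra.
have weigh (k : nat) (u B : R) : `|u| <= B -> `|a k * u| <= B.
  move=> uB; rewrite normrM (ger0_norm (a0 k)).
  by apply: le_trans uB; rewrite ler_piMl.
pose S1 := \sum_(i < N) (\sum_(j < N) I (y i - y j - gamma) - 2 * r * N%:R).
pose S2 := \sum_(i < N) a i *
  (\sum_(j < N) I (y i - y j - gamma) - \sum_(j < N) I (y j + gamma)).
pose S3 := \sum_(j < N) a j *
  (\sum_(i < N) I (y i - y j - gamma) - \sum_(i < N) I (y i - gamma)).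
pose S4 := \sum_(i < N) \sum_(j < N) a i * a j * I (y i - y j - gamma).
have -> : (pair_count (vdc_atom gamma) gamma r N)%:R - 2 * r * N%:R ^+ 2
    = S1 - S2 - S3 + S4.
  rewrite pair_count_sum /S1 sumrB sumr_const card_ord -(mulr_natr (2 * r * N%:R) N).
  have -> : S3 = \sum_(i < N) \sum_(j < N)
      a j * (I (y i - y j - gamma) - I (y i - gamma)).
    rewrite exchange_big /=; apply: eq_bigr => j _.
    by rewrite -sumrB mulr_sumr.
  have -> : S2 = \sum_(i < N) \sum_(j < N)
      a i * (I (y i - y j - gamma) - I (y j + gamma)).
    by apply: eq_bigr => j _; rewrite -sumrB mulr_sumr.
  have -> : forall A B C E : R, A - B * N%:R - C - E + S4
      = A - C - E + S4 - B * N%:R by move=> *; ring.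
  rewrite -!sumrB -big_split /=; congr (_ - _); last by rewrite expr2 mulrA.
  apply: eq_bigr => i _; rewrite -!sumrB -big_split /=; apply: eq_bigr => j _.
  by rewrite -vdc_atom_indicator // ltW.
have b1 : `|S1| <= N%:R * D by apply: norm_sum_le.
have b2 : `|S2| <= N%:R * (2 * D).
  by apply: norm_sum_le => i; apply: weigh; apply: diff (row i) rowb.
have b3 : `|S3| <= N%:R * (2 * D).
  by apply: norm_sum_le => j; apply: weigh; apply: diff (col j) colc.
have S40 : 0 <= S4 by do 2!apply: sumr_ge0 => ? _; rewrite !mulr_ge0.
(* Two points within [gamma / 2] of 0 can only be at distance about [gamma]
   from each other if both are close to the boundary. *)
have b4 : S4 <= (4 * r * N%:R + 2 * D) * (2 * r * N%:R + D).
  have ea k : e k <= a k.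
    rewrite /e /a; case: (leP _ (gamma / 2 - _)) => // h.
    by rewrite (_ : _ <= gamma / 2) //; lra.
  have point (i j : nat) : a i * a j * I (y i - y j - gamma)
      <= (a i - e i) * I (y i - y j - gamma).
    have ei : 0 <= (a i - e i) * I (y i - y j - gamma) by rewrite mulr_ge0 // subr_ge0.
    move: ei; rewrite /a /e /I.
    case: (leP (dist_int (y i)) (gamma / 2)) => h1 ei; last by rewrite !mul0r.
    case: (leP (dist_int (y j)) (gamma / 2)) => h2; last by rewrite mulr0 mul0r.
    case: (leP (dist_int (y i - y j - gamma)) r) => h3; last by rewrite !mulr0.
    case: (leP (dist_int (y i)) (gamma / 2 - 2 * r)) => h4; last by rewrite subr0 mulr1.
    exfalso.
    have := dist_intD (y i - y j - gamma) (- y i + y j).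
    rewrite (_ : _ + (- y i + y j) = - gamma); last by ring.
    have := dist_intD (- y i) (y j).
    by rewrite !dist_intN dg; lra.
  apply: (@le_trans _ _ (\sum_(i < N) (a i - e i) * (2 * r * N%:R + D))).
    apply: ler_sum => i _.
    apply: (@le_trans _ _ (\sum_(j < N) (a i - e i) * I (y i - y j - gamma))).
      by apply: ler_sum => j _; exact: point.
    rewrite -mulr_sumr ler_wpM2l ?subr_ge0 ?ea //.
    by have := row i; rewrite ler_norml => /andP[_]; lra.
  rewrite -mulr_suml ler_wpM2r //.
    by rewrite addr_ge0 ?DE ?ler0n // !mulr_ge0 // ltW.
  have mass (rho : R) : 0 <= rho -> rho < 1 / 2 ->
      `|\sum_(i < N) (dist_int (y i) <= rho)%R%:R - 2 * rho * N%:R| <= D.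
    by have := disc 0 rho; under eq_bigr do rewrite subr0.
  have := mass (gamma / 2); have := mass (gamma / 2 - 2 * r).
  rewrite sumrB !ler_norml => h1 h2.
  have /andP[? ?] := h1 ltac:(lra) ltac:(lra).
  have /andP[? ?] := h2 ltac:(lra) ltac:(lra).
  rewrite /a /e; lra.
have := ler_normD (S1 - S2 - S3) S4; have := ler_normB (S1 - S2) S3.
have := ler_normB S1 S2; rewrite (ger0_norm S40).
lra.
Qed.

(** * Asymptotics and the two properties of the sequence *)

(** Apply ln t <= t - 1 at t = N^e; the successor is absorbed by N^e >= 1. *)
Lemma trunc_log_le_powR (R : realType) (e : R) (N : nat) : 0 < e -> (0 < N)%N ->
  (trunc_log 2 N).+1%:R <= ((e * ln 2)^-1 + 1) * N%:R `^ e.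
Proof.
move=> e0 N0; have N1 : 1 <= N%:R :> R by rewrite ler1n.
have u1 : 1 <= N%:R `^ e by rewrite -[leLHS](powRr0 N%:R) ler_powR // ltW.
have l2 : 0 < ln 2 :> R by rewrite ln_gt0 // ltr1n.
have tN : (trunc_log 2 N)%:R * ln 2 <= ln N%:R :> R.
  rewrite mulr_natl -lnXn // ler_ln ?posrE ?exprn_gt0 // ?ltr0n //.
  by rewrite -natrX ler_nat trunc_logP.
have lu : e * ln N%:R <= N%:R `^ e.
  rewrite -ln_powR; have := @le_ln1Dx R (N%:R `^ e - 1).
  by rewrite addrCA subrr addr0 => h; have := h ltac:(lra); lra.
rewrite -[X in X <= _]natr1 mulrDl mul1r lerD //.
rewrite mulrC ler_pdivlMr ?mulr_gt0 // mulrCA.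
by apply: le_trans lu; rewrite ler_pM2l.
Qed.

Lemma cvg_powRN_infty (R : realType) (p : R) : 0 < p ->
  (fun N : nat => (N%:R `^ p)^-1) @ \oo --> (0 : R).
Proof.
move=> p0; apply/cvgr0Pnorm_le => e e0; near=> N.
rewrite ger0_norm ?invr_ge0 ?powR_ge0 //.
rewrite -[leRHS]invrK lef_pV2 ?posrE ?invr_gt0 ?powR_gt0 //; last first.
  by rewrite ltr0n; near: N; exact: nbhs_infty_gt.
have -> : e^-1 = (e^-1 `^ p^-1) `^ p.
  by rewrite -powRrM mulVf ?gt_eqF // powRr1 // invr_ge0 ltW.
apply: ge0_ler_powR; rewrite ?nnegrE ?powR_ge0 ?ler0n ?(ltW p0) //.
near: N; exact: nbhs_infty_ger.
Unshelve. all: by end_near. Qed.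

Lemma vdc_atom_weak_PPC (R : realType) (gamma delta : R) :
  0 < gamma -> gamma <= 1 / 2 -> 0 < delta -> delta < 1 ->
  weak_PPC gamma delta (vdc_atom gamma).
Proof.
(* With u = N^e and v = N^delta, this exponent gives N = u^2 v and N^(2-delta) = N u^2. *)
move=> g0 g12 d0 d1 s s0; pose e := (1 - delta) / 2.
have e0 : 0 < e by rewrite /e; lra.
pose C : R := (e * ln 2)^-1 + 1.
pose K := (4 * s + 2 * C) * (2 * s + C).
(* After division by N u^2, the term 5 N D with D <= C u yields 5 C / u, and the product term, at
   most K u^4, yields K u^2 / N = K / v. *)
pose E N := 5 * C * (N%:R `^ e)^-1 + K * (N%:R `^ delta)^-1.
have E0 : E @ \oo --> (0 : R).
  rewrite -[X in _ --> X](_ : 5 * C * 0 + K * 0 = 0); last by rewrite !mulr0 addr0.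
  by apply: cvgD; apply: cvgMl_tmp; exact: cvg_powRN_infty.
apply: (@squeeze_cvgr _ _ _ _ (fun N => 2 * s - E N) (fun N => 2 * s + E N)).
- near=> N; rewrite -ler_distlC.
  have N0 : (0 < N)%N by near: N; exact: nbhs_infty_gt.
  have n0 : 0 < N%:R :> R by rewrite ltr0n.
  have vsmall : (N%:R `^ delta)^-1 < gamma / 4 / s.
    near: N; apply: cvgr_lt (cvg_powRN_infty d0) _ _.
    by rewrite divr_gt0 // divr_gt0.
  set n := N%:R : R; set u := n `^ e; set v := n `^ delta.
  have u0 : 0 < u by exact: powR_gt0.
  have v0 : 0 < v by exact: powR_gt0.
  have u1 : 1 <= u by rewrite /u -[leLHS](powRr0 n) ler_powR ?ler1n // ltW.
  have nE : n = u ^+ 2 * v.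
    rewrite /u /v expr2 -!powRD ?(gt_eqF n0) ?implybT //.
    by rewrite -[LHS]powRr1 ?ltW //; congr powR; rewrite /e; field.
  have qE : n `^ (2 - delta) = n * u ^+ 2.
    rewrite -[X in _ = X * _]powRr1 ?ltW // /u expr2 -!powRD ?(gt_eqF n0) ?implybT //.
    by congr powR; rewrite /e; field.
  have small : s / v < gamma / 4.
    by rewrite mulrC -ltr_pdivlMr.
  have := @vdc_atom_pair_count _ gamma (s / v) _ N g0 g12 (divr_gt0 s0 v0) small erefl.
  set P := (pair_count _ _ _ _)%:R; set D := (trunc_log 2 N).+1%:R => main.
  have D0 : 0 <= D by exact: ler0n.
  have DC : D <= C * u by exact: trunc_log_le_powR.
  have C0 : 0 <= C by rewrite /C addr_ge0 // invr_ge0 mulr_ge0 ?ln_ge0 ?ler1n // ltW.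
  (* In the product term r N = s u^2, so this weaker bound already has the right order. *)
  have DC2 : D <= C * u ^+ 2.
    apply: le_trans DC _; rewrite ler_wpM2l // expr2 ler_peMl //; exact: ltW.
  have rn c : c * (s / v) * n = c * s * u ^+ 2 by rewrite nE; field; rewrite gt_eqF.
  rewrite qE distrC.
  have -> : P / (n * u ^+ 2) - 2 * s = (P - 2 * (s / v) * n ^+ 2) / (n * u ^+ 2).
    by rewrite nE; field; rewrite !gt_eqF.
  have q0 : 0 < n * u ^+ 2 by rewrite mulr_gt0 ?exprn_gt0.
  rewrite normrM normfV (gtr0_norm q0) ler_pdivrMr //; apply: le_trans main _.
  have -> : E N * (n * u ^+ 2) = 5 * n * (C * u)
     + (4 * s * u ^+ 2 + 2 * (C * u ^+ 2)) * (2 * s * u ^+ 2 + C * u ^+ 2).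
    rewrite /E -/n -/u -/v /K mulrDl; congr (_ + _); first by field; rewrite gt_eqF.
    by rewrite nE; field; rewrite gt_eqF.
  rewrite !rn lerD //; first by rewrite ler_wpM2l // mulr_ge0 // ltW.
  have su : 0 <= s * u ^+ 2 by rewrite mulr_ge0 ?exprn_ge0 // ltW.
  by apply: ler_pM; lra.
- rewrite -[X in _ --> X]subr0; apply: cvgB => //; exact: cvg_cst.
- rewrite -[X in _ --> X]addr0; apply: cvgD => //; exact: cvg_cst.
Unshelve. all: by end_near. Qed.

Lemma vdc_atom_not_equidistributed (R : realType) (gamma : R) :
  0 < gamma -> gamma <= 1 / 2 -> ~ equidistributed (vdc_atom gamma).
Proof.
(* The degenerate interval [0, 0] detects the atom: equidistribution would force visit frequency 0
   there. *)
move=> g0 g12 /(_ 0 0 (lexx _) (lexx _) ltr01); rewrite subrr => visits.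
(* The constant of [trunc_log_le_powR] for e = 1/2, which makes the discrepancy over [N] of order
   N^(-1/2). *)
pose C : R := (2^-1 * ln 2)^-1 + 1.
have C0 : 0 < C by rewrite /C ltr_wpDl // invr_ge0 mulr_ge0 ?ln_ge0 ?ler1n // invr_ge0.
have half0 : 0 < 2^-1 :> R by rewrite invr_gt0.
have lower : \forall N \near \oo,
    gamma - C * (N%:R `^ 2^-1)^-1 <= (visit_count (vdc_atom gamma) 0 0 N)%:R / N%:R.
  near=> N.
  have N0 : (0 < N)%N by near: N; exact: nbhs_infty_gt.
  have n0 : 0 < N%:R :> R by rewrite ltr0n.
  set u := N%:R `^ 2^-1; have u0 : 0 < u by exact: powR_gt0.
  have nE : N%:R = u * u.
    rewrite /u -powRD ?(gt_eqF n0) ?implybT // -[LHS]powRr1 ?ltW //.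
    by congr powR; field.
  have CE : C * u^-1 * N%:R = C * u by rewrite nE; field; rewrite gt_eqF.
  rewrite ler_pdivlMr // mulrBl CE.
  have g4 : gamma / 2 < 1 / 2 by lra.
  have g5 : 0 <= gamma / 2 by lra.
  have := @vdc_discrepancy _ N 0 (gamma / 2) g5 g4.
  under eq_bigr do rewrite subr0.
  have DC : _ <= C * u := @trunc_log_le_powR _ _ N half0 N0.
  have le : \sum_(i < N) (dist_int (vdc R i) <= gamma / 2)%R%:R
      <= (visit_count (vdc_atom gamma) 0 0 N)%:R :> R.
    rewrite visit_count_sum; apply: ler_sum => i _; rewrite /vdc_atom /=.
    by case: ifP => // _; rewrite /mod1 floor0 subr0 lexx.
  by rewrite ler_norml => /andP[h _]; lra.
have lim : (fun N : nat => gamma - C * (N%:R `^ 2^-1)^-1) @ \oo --> gamma - C * 0.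
  by apply: cvgB; [exact: cvg_cst|apply: cvgMl_tmp; exact: cvg_powRN_infty].
have : gamma - C * 0 <= 0 by exact: ler_cvg_to lim visits lower.
by rewrite mulr0 subr0 leNgt g0.
Unshelve. all: by end_near. Qed.

Theorem theorem1p2 (R : realType) (gamma delta : R) :
  0 < gamma -> gamma <= 1 / 2 -> 0 < delta -> delta < 1 ->
  exists x : nat -> R, weak_PPC gamma delta x /\ ~ equidistributed x.
Proof.
move=> g0 g12 d0 d1; exists (vdc_atom gamma); split.
  exact: vdc_atom_weak_PPC.
exact: vdc_atom_not_equidistributed.
Qed.
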